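(* Let $\mathcal D$ be the clutter of minimal vertex covers of $\mathcal C$. If $\overline{R[It]}=R_s(I)$ and $|S\cap B|\le 2$ for every edge $S$ of $\mathcal C$ and every edge $B$ of $\mathcal D$, then $R[It]$ is normal.
   Context: Let $R=K[x_1,\ldots,x_n]$ be a polynomial ring over a field $K$, and let $I\subset R$ be an ideal of height $g\ge 2$ minimally generated by a finite set $F=\{x^{v_1},\ldots,x^{v_q}\}$ of square-free monomials of degree at least two (where $x^a=x_1^{a_1}\cdots x_n^{a_n}$). Each variable $x_i$ divides at least one monomial of $F$. A clutter on $X$ is a family of subsets of $X$ (edges), none of which is included in another. $\mathcal C$ is the clutter with vertex set $X=\{x_1,\ldots,x_n\}$ and edges $S_k=\mathrm{supp}(x^{v_k})$, the set of variables dividing $x^{v_k}$, $k=1,\ldots,q$. A vertex cover of $\mathcal C$ is a subset of $X$ meeting every edge of $\mathcal C$; it is a minimal vertex cover if no proper subset is a vertex cover. The edges of $\mathcal D$ are the minimal vertex covers of $\mathcal C$. The Rees algebra of $I$ is $R[It]=R\oplus It\oplus I^2t^2\oplus\cdots\subset R[t]$; $\overline{R[It]}$ is its integral closure in its field of fractions, and $R[It]$ is normal if $R[It]=\overline{R[It]}$. Let $\mathfrak p_1,\ldots,\mathfrak p_s$ be the minimal primes of $I$; $I^{(i)}=\mathfrak p_1^i\cap\cdots\cap\mathfrak p_s^i$, and the symbolic Rees algebra is $R_s(I)=R+I^{(1)}t+I^{(2)}t^2+\cdots\subset R[t]$. *)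

(* Defs.v *)
From HB Require Import structures.
From mathcomp Require Import all_boot all_order all_algebra.
From mathcomp Require Import boolp classical_sets.
From mathcomp Require Import mpoly.

Set Implicit Arguments.
Unset Strict Implicit.
Unset Printing Implicit Defensive.

Import GRing.Theory.
Local Open Scope classical_set_scope.
Local Open Scope ring_scope.

Section Ideals.
Variable R : comNzRingType.
Implicit Types (I J P : set R) (S : set R).

(* Unlike [idealr_closed], this allows the unit ideal. *)
Definition is_ideal I : Prop :=
  [/\ I 0, forall a b, I a -> I b -> I (a + b) & forall r a, I a -> I (r * a)].

Definition ideal_gen S : set R := smallest is_ideal S.

(* [ideal_pow I 0] is the unit ideal, since the empty product is 1. *)
Definition ideal_pow I (k : nat) : set R :=
  ideal_gen [set x | exists2 a : 'I_k -> R,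
    forall j, I (a j) & x = \prod_(j < k) a j].

Definition is_prime P : Prop :=
  [/\ is_ideal P, ~ P 1 & forall a b, P (a * b) -> P a \/ P b].

Definition minimal_primes I : set (set R) :=
  [set P | [/\ is_prime P, I `<=` P &
    forall Q, is_prime Q -> I `<=` Q -> Q `<=` P -> Q = P]].

Definition prime_chain P (h : nat) : Prop :=
  exists c : nat -> set R,
    [/\ forall i, (i <= h)%N -> is_prime (c i),
        forall i, (i < h)%N -> c i `<` c i.+1 & c h = P].

Definition prime_height P (h : nat) : Prop :=
  prime_chain P h /\ forall k, prime_chain P k -> (k <= h)%N.

(* Primes of infinite height do not affect the minimum. *)
Definition ideal_height I (g : nat) : Prop :=
  (exists P, [/\ is_prime P, I `<=` P & prime_height P g]) /\
  forall P h, is_prime P -> I `<=` P -> prime_height P h -> (g <= h)%N.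

(* The intersection of the ordinary powers of the minimal primes of I. *)
Definition symbolic_pow I (k : nat) : set R :=
  \bigcap_(P in minimal_primes I) ideal_pow P k.

Definition rees I : set {poly R} :=
  [set f | forall k, ideal_pow I k f`_k].

Definition symbolic_rees I : set {poly R} :=
  [set f | forall k, symbolic_pow I k f`_k].

End Ideals.

Section IntegralClosure.
Variable S : idomainType.
Implicit Types A : set S.

(* The field of fractions of a subring A of S, inside that of S. *)
Definition frac_of A : set {fraction S} :=
  [set z | exists a b, [/\ A a, A b, b != 0 & z = tofrac a / tofrac b]].

Definition integral_over A (z : {fraction S}) : Prop :=
  exists p : {poly S},
    [/\ p \is monic, forall i, A p`_i & root (map_poly (@tofrac S) p) z].

Definition integral_closure A : set {fraction S} :=
  [set z | frac_of A z /\ integral_over A z].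

Definition in_frac A : set {fraction S} := [set tofrac a | a in A].

Definition is_normal A : Prop := integral_closure A = in_frac A.

End IntegralClosure.

Section Clutters.
Variable n : nat.
Implicit Types (m : 'X_{1..n}) (C : {set {set 'I_n}}) (B : {set 'I_n}).

Definition squarefree_mon m : Prop := forall i, (m i <= 1)%N.

Definition mon_supp m : {set 'I_n} := [set i | m i != 0%N]%SET.

Definition clutter_of q (v : 'I_q -> 'X_{1..n}) : {set {set 'I_n}} :=
  [set mon_supp (v k) | k : 'I_q]%SET.

Definition vertex_cover C B : bool :=
  [forall S in C, (B :&: S)%SET != finset.set0].

Definition min_cover_clutter C : {set {set 'I_n}} :=
  [set B | minset (vertex_cover C) B]%SET.

End Clutters.

Section MonomialIdeals.
Variables (K : fieldType) (n q : nat).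
Implicit Types (v : 'I_q -> 'X_{1..n}) (I : set {mpoly K[n]}).

Definition mon_ideal v (J : {set 'I_q}) : set {mpoly K[n]} :=
  ideal_gen [set 'X_[v k] | k in [set` J]].

(* No proper subfamily generates I; in particular v is injective. *)
Definition minimally_generated I v : Prop :=
  I = mon_ideal v [set: 'I_q]%SET /\
  forall J : {set 'I_q}, J \proper [set: 'I_q]%SET -> mon_ideal v J <> I.

End MonomialIdeals.

(* Main.v *)
Require Import Defs.
From HB Require Import structures.
From mathcomp Require Import all_boot all_order all_algebra.
From mathcomp Require Import boolp classical_sets.
From mathcomp Require Import mpoly.
From mathcomp Require Import zify.

(** Everything in sight is spanned by monomials, so the question is which
    monomials [x^a] lie in the [k]-th graded piece of each algebra.

    For an ideal generated by monomials, the minimal primes are the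
    ideals [P_B] generated by the variables of a minimal vertex cover [B]
    ([minimal_primes_mon]).  Hence [x^a] lies in the [k]-th symbolic power iff
    [a(B) >= k] for every such [B], where [a(B)] is the sum of the exponents of
    [a] over [B] ([symbolic_pow_mon]), while it lies in [I^k] iff it is
    divisible by a product of [k] edge monomials ([mon_ideal_pow]).  Since
    [R[It]] is contained in its integral closure, which is assumed to be the
    symbolic Rees algebra, normality amounts to the implication from the first
    condition to the second ([covered_in_mon_pow]), proved by induction on [k].

    Let [a(B) >= k > 0] for every [B].  By assumption [x^a t^k] is integral
    over [R[It]], and comparing monomials in an equation of integral dependence
    shows that [x^(Ma)] is in [I^(kM)] for some [M > 0] ([integral_monomial]):
    a product of [kM] edges divides [x^(Ma)].  Let [S] be any one of these
    edges; as [S] is square-free, [x^S] divides [x^a].  It remains to see that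
    [a - S] has degree at least [k - 1] on each [B].  If [a(B) = k], then the
    [kM] edges have total degree at most [kM] on [B], whereas each of them meets
    [B]; hence [S] meets [B] exactly once, and [(a - S)(B) = k - 1].  If
    [a(B) > k], then [(a - S)(B) >= k + 1 - 2], because [S] meets [B] at most
    twice. *)

Import GRing.Theory.
Local Open Scope classical_set_scope.
Local Open Scope ring_scope.

(** * Ideals, powers and primes in a commutative ring *)

Lemma ideal_genP {R : comNzRingType} (S : set R) :
  is_ideal (ideal_gen S).
Proof.
split.
- by move=> J [[J0 _ _] _].
- by move=> a b Sa Sb J JP; have [[_ JD _] _] := JP; apply: JD; [apply: Sa|apply: Sb].
- by move=> r a Sa J JP; have [[_ _ JM] _] := JP; apply: JM; apply: Sa.
Qed.

Lemma ideal_sum {R : comNzRingType} {J : set R} (JP : is_ideal J)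
    {T : eqType} (r : seq T) (F : T -> R) :
  {in r, forall x, J (F x)} -> J (\sum_(x <- r) F x).
Proof.
case: JP => J0 JD _ JF; rewrite big_seq_cond.
by apply: big_ind => // x; rewrite andbT => /JF.
Qed.

Lemma prime_prod {R : comNzRingType} {P : set R} (PP : is_prime P)
    {T : finType} (F : T -> R) :
  P (\prod_(i : T) F i) -> exists i, P (F i).
Proof.
case: PP => _ P1 PM; elim/big_ind: _ => //.
- by move=> x y hx hy /PM [/hx|/hy].
- by move=> i _; exists i.
Qed.

Lemma prime_exp {R : comNzRingType} {P : set R} (PP : is_prime P) (x : R) k :
  P (x ^+ k) -> k != 0%N /\ P x.
Proof.
case: PP => _ P1 PM; elim: k => [|k IH]; first by rewrite expr0 => /P1.
by rewrite exprS => /PM [|/IH []].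
Qed.

Lemma ideal_pow0 {R : comNzRingType} (J : set R) x : ideal_pow J 0 x.
Proof.
have [_ _ JM] := ideal_genP [set y | exists2 a : 'I_0 -> R,
  forall j, J (a j) & y = \prod_(j < 0) a j].
rewrite -[x]mulr1; apply: JM; apply: sub_gen_smallest; exists (fun=> 0).
  by case.
by rewrite big_ord0.
Qed.

(** The multipliers [x] with [a * x] in [J^(k+1)] form an ideal, so it is enough
    to look at the products of [k] elements of [J] that generate [J^k]. *)
Lemma ideal_powS {R : comNzRingType} {J : set R} {k : nat} {a x : R} :
  J a -> ideal_pow J k x -> ideal_pow J k.+1 (a * x).
Proof.
move=> Ja; have [P0 PD PM] := ideal_genP [set y | exists2 b : 'I_k.+1 -> R,
  forall j, J (b j) & y = \prod_(j < k.+1) b j].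
apply: (smallest_sub (X := [set x | ideal_pow J k.+1 (a * x)])).
  split=> /= [|y z Jy Jz|r y Jy].
  - by rewrite mulr0.
  - by rewrite mulrDr; apply: PD.
  - by rewrite mulrCA; apply: PM.
move=> _ [b bJ ->]; apply: sub_gen_smallest.
exists (fun j => oapp b a (unlift ord0 j)).
  by move=> j; case: (unlift ord0 j) => //= j'; apply: bJ.
rewrite big_ord_recl unlift_none /=; congr (_ * _).
by apply: eq_bigr => j _; rewrite liftK.
Qed.

(** * Monomial ideals *)

(** The span of the monomials satisfying [W]; it is an ideal as soon as [W] is
    stable under multiplication by monomials. *)
Definition monomial_ideal {n : nat} (K : fieldType) (W : 'X_{1..n} -> Prop) :
    set {mpoly K[n]} :=
  [set f | forall m, m \in msupp f -> W m].

Lemma monomial_idealP {n : nat} (K : fieldType) {W : 'X_{1..n} -> Prop} :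
  (forall m1 m2, W m2 -> W (m1 + m2)%MM) -> is_ideal (monomial_ideal K W).
Proof.
move=> Wup; split.
- by move=> m; rewrite msupp0.
- by move=> f g Wf Wg m /msuppD_le; rewrite mem_cat => /orP [/Wf|/Wg].
- by move=> r f Wf m /msuppM_le /allpairsP [[m1 m2] /= [_ /Wf Wm2 ->]]; apply: Wup.
Qed.

Lemma monomial_idealX {n : nat} {K : fieldType} {W : 'X_{1..n} -> Prop} m :
  monomial_ideal K W 'X_[m] <-> W m.
Proof.
split=> [|Wm m']; first by apply; rewrite msuppX inE.
by rewrite msuppX inE => /eqP ->.
Qed.

Lemma monomial_ideal_sub {n : nat} {K : fieldType} {W : 'X_{1..n} -> Prop}
    (J : set {mpoly K[n]}) (JP : is_ideal J) :
  (forall m, W m -> J 'X_[m]) -> monomial_ideal K W `<=` J.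
Proof.
move=> WJ f Wf; rewrite [f]mpolyE; apply: (ideal_sum JP) => m /Wf /WJ.
by case: JP => _ _ JM; rewrite -mul_mpolyC; apply: JM.
Qed.

(** A filtration of the monomials that is compatible with multiplication bounds
    the powers of an ideal: this is applied both to divisibility by [k] generators
    and to the degree on a vertex cover. *)
Lemma ideal_pow_monomial {n : nat} {K : fieldType} (J : set {mpoly K[n]})
    (W : nat -> 'X_{1..n} -> Prop)
    (W0 : forall m, W 0%N m)
    (Wup : forall k m1 m2, W k m2 -> W k (m1 + m2)%MM)
    (WD : forall k m1 m2, W 1%N m1 -> W k m2 -> W k.+1 (m1 + m2)%MM) :
  J `<=` monomial_ideal K (W 1%N) ->
  forall k, ideal_pow J k `<=` monomial_ideal K (W k).
Proof.
move=> JW k; apply: smallest_sub; first exact: (monomial_idealP K (Wup k)).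
move=> _ [a aJ ->]; elim: k a aJ => [|k IH] a aJ; first by move=> m _; apply: W0.
move=> m; rewrite big_ord_recl => /msuppM_le /allpairsP [[m1 m2] /= [h1 h2 ->]].
by apply: WD; [exact: (JW _ (aJ ord0))|exact: (IH _ (fun j => aJ (lift ord0 j)))].
Qed.

(** * Powers of an ideal generated by monomials *)

(** Divisibility of [x^m] by a product of [k] of the monomials [x^(v e)], phrased
    so that these can be peeled off one at a time. *)
Fixpoint in_mon_pow {n q : nat} (v : 'I_q -> 'X_{1..n}) (k : nat)
    (m : 'X_{1..n}) : Prop :=
  if k is k'.+1 then exists e m', in_mon_pow v k' m' /\ m = (v e + m')%MM
  else True.

Lemma in_mon_pow_up {n q : nat} (v : 'I_q -> 'X_{1..n}) k m1 m2 :
  in_mon_pow v k m2 -> in_mon_pow v k (m1 + m2)%MM.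
Proof.
elim: k m1 m2 => // k IH m1 m2 [e [m' [km' ->]]].
by exists e, (m1 + m')%MM; split; [apply: IH|rewrite !addmA (addmC m1)].
Qed.

Lemma mon_ideal_gen {K : fieldType} {n q : nat} (v : 'I_q -> 'X_{1..n}) e :
  (mon_ideal v [set: 'I_q]%SET : set {mpoly K[n]}) 'X_[v e].
Proof. by apply: sub_gen_smallest; exists e; rewrite //= inE. Qed.

Lemma mon_ideal_pow {K : fieldType} {n q : nat} (v : 'I_q -> 'X_{1..n}) k :
  ideal_pow (mon_ideal v [set: 'I_q]%SET) k
    = monomial_ideal K (in_mon_pow v k).
Proof.
apply/seteqP; split.
  apply: (ideal_pow_monomial _ (in_mon_pow v)) => //.
  - exact: in_mon_pow_up.
  - move=> {}k m1 m2 [e [m' [_ ->]]] km2; exists e, (m' + m2)%MM.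
    by split; [apply: in_mon_pow_up|rewrite addmA].
  - apply: smallest_sub; first by apply: monomial_idealP; apply: in_mon_pow_up.
    by move=> _ [e _ <-]; apply/monomial_idealX; exists e, 0%MM; rewrite addm0.
apply: monomial_ideal_sub; first exact: ideal_genP.
elim: k => [|k IH] m; first by move=> _; apply: ideal_pow0.
move=> [e [m' [/IH km' ->]]]; rewrite mpolyXD.
by apply: ideal_powS km'; apply: mon_ideal_gen.
Qed.

(** * Degree on a set of variables and the primes generated by variables *)

Definition deg_on {n : nat} (B : {set 'I_n}) (m : 'X_{1..n}) : nat :=
  (\sum_(i in B) m i)%N.

Lemma deg_onD {n : nat} (B : {set 'I_n}) m1 m2 :
  deg_on B (m1 + m2)%MM = (deg_on B m1 + deg_on B m2)%N.
Proof. by rewrite -big_split; apply: eq_bigr => i _; rewrite mnmDE. Qed.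

Lemma deg_onMn {n : nat} (B : {set 'I_n}) m k :
  deg_on B (m *+ k)%MM = (deg_on B m * k)%N.
Proof. by rewrite /deg_on big_distrl; apply: eq_bigr => i _; rewrite mulmnE. Qed.

Lemma deg_on_gt0 {n : nat} (B : {set 'I_n}) (m : 'X_{1..n}) :
  (0 < deg_on B m)%N <-> exists2 i, i \in B & m i != 0%N.
Proof.
rewrite lt0n sum_nat_eq0 negb_forall; split.
- by case/existsP => i; rewrite negb_imply => /andP [iB mi]; exists i.
- by case=> i iB mi; apply/existsP; exists i; rewrite negb_imply iB.
Qed.

Lemma deg_on_squarefree {n : nat} (B : {set 'I_n}) {m : 'X_{1..n}} :
  squarefree_mon m -> deg_on B m = #|mon_supp m :&: B|.
Proof.
move=> m1; rewrite -sum1_card /deg_on (bigID (fun i => m i == 0%N)) /=.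
rewrite big1 ?add0n => [|i /andP [_ /eqP //]].
apply: eq_big => [i|i /andP [_ mi]]; first by rewrite !inE andbC.
by have := m1 i; case: (m i) mi => [|[]].
Qed.

(** The ideal generated by the variables in [B], described by its monomials. *)
Definition face_ideal {n : nat} (K : fieldType) (B : {set 'I_n}) :
    set {mpoly K[n]} :=
  monomial_ideal K (fun m => (0 < deg_on B m)%N).

(** This ideal is the kernel of the substitution that sends the variables of [B]
    to [0] and fixes the others; the target is an integral domain. *)
Lemma face_ideal_prime {n : nat} (K : fieldType) (B : {set 'I_n}) :
  is_prime (face_ideal K B).
Proof.
pose lq : n.-tuple {mpoly K[n]} := [tuple (if i \in B then 0 else 'X_i) | i < n].
have lqX m : 'X_[m] \mPo lq = if (0 < deg_on B m)%N then 0 else 'X_[m].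
  rewrite comp_mpolyX; case: ifPn => [/deg_on_gt0 [i iB mi]|mB].
    rewrite (bigD1 i) //= tnth_mktuple iB expr0n (negbTE mi).
    by rewrite mul0r.
  rewrite mpolyXE_id; apply: eq_bigr => i _; rewrite tnth_mktuple.
  case: ifP => // iB; case: (eqVneq (m i) 0%N) => [->|mi]; first by rewrite !expr0.
  by case/negP: mB; apply/deg_on_gt0; exists i.
have kerE f : face_ideal K B f <-> f \mPo lq = 0.
  rewrite comp_mpolyEX; split=> [Bf|f0 m mf].
    by rewrite big_seq big1 // => m /Bf mB; rewrite lqX mB scaler0.
  case: (posnP (deg_on B m)) => // mB.
  have := congr1 (mcoeff m) f0; rewrite raddf_sum /= mcoeff0.
  rewrite (bigD1_seq m) ?msupp_uniq //= big1 ?addr0.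
    rewrite mcoeffZ lqX mB ltnn mcoeffX eqxx mulr1 => fm.
    by move: mf; rewrite mcoeff_msupp fm eqxx.
  move=> m' m'm; rewrite mcoeffZ lqX; case: ifP; rewrite ?mcoeff0 ?mulr0 //.
  by rewrite mcoeffX (negbTE m'm) mulr0.
split.
- by apply: monomial_idealP => m1 m2; rewrite deg_onD addn_gt0 orbC => ->.
- by rewrite kerE comp_mpoly1 => /eqP; rewrite oner_eq0.
- move=> f h; rewrite !kerE rmorphM /= => /eqP.
  by rewrite mulf_eq0 => /orP [] /eqP; [left|right].
Qed.

Lemma face_ideal_sub {n : nat} {K : fieldType} (B : {set 'I_n})
    (J : set {mpoly K[n]}) (JP : is_ideal J) :
  (forall i, i \in B -> J 'X_i) -> face_ideal K B `<=` J.
Proof.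
move=> BJ; apply: (monomial_ideal_sub _ JP) => m /deg_on_gt0 [i /BJ Ji mi].
have [_ _ JM] := JP.
by rewrite -(submK (m := U_(i)%MM) (m' := m)) ?lep1mP // mpolyXD; apply: JM.
Qed.

Lemma face_ideal_pow_deg {n : nat} (K : fieldType) (B : {set 'I_n}) k :
  ideal_pow (face_ideal K B) k
    `<=` monomial_ideal K (fun m => (k <= deg_on B m)%N).
Proof.
apply: (ideal_pow_monomial _ (fun k m => (k <= deg_on B m)%N)) => //.
- by move=> {}k m1 m2 km; rewrite deg_onD (leq_trans km) ?leq_addl.
- by move=> {}k m1 m2 m1B km; rewrite deg_onD -add1n leq_add.
Qed.

Lemma face_ideal_powX {n : nat} (K : fieldType) (B : {set 'I_n}) k m :
  (k <= deg_on B m)%N -> ideal_pow (face_ideal K B) k 'X_[m].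
Proof.
elim: k m => [|k IH] m km; first exact: ideal_pow0.
have [|i iB mi] := (deg_on_gt0 B m).1; first exact: leq_trans km.
have U1 : deg_on B U_(i)%MM = 1%N.
  rewrite /deg_on (bigD1 i) //= mnm1E eqxx big1 // => j /andP [_ ji].
  by rewrite mnm1E eq_sym (negbTE ji).
have mE : (U_(i) + (m - U_(i)))%MM = m by rewrite addmC submK // lep1mP.
rewrite -mE mpolyXD; apply: ideal_powS.
  by apply/monomial_idealX; rewrite U1.
by apply: IH; move: km; rewrite -{1}mE deg_onD U1.
Qed.

(** * Symbolic powers of a monomial ideal *)

(** A prime contains a monomial iff it contains one of the variables dividing
    it, so it contains the ideal iff its variables cover all the edges. *)
Lemma mon_ideal_prime {K : fieldType} {n q : nat} {v : 'I_q -> 'X_{1..n}}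
    {P : set {mpoly K[n]}} (PP : is_prime P) :
  mon_ideal v [set: 'I_q]%SET `<=` P <->
  vertex_cover (clutter_of v) [set i | `[< P 'X_i >]]%SET.
Proof.
split=> [IP|/forall_inP cov].
  apply/forall_inP => _ /imsetP [e _ ->].
  have : P 'X_[v e] by apply: IP; apply: mon_ideal_gen.
  rewrite mpolyXE_id => /(prime_prod PP) [i /(prime_exp PP) [vi Pi]].
  by apply/set0Pn; exists i; rewrite !inE vi andbT; apply/asboolP.
have [JP _ _] := PP; apply: smallest_sub => // _ [e _ <-].
have /set0Pn [i] : ([set i | `[< P 'X_i >]] :&: mon_supp (v e))%SET != finset.set0.
  by apply: cov; apply: imset_f.
rewrite !inE => /andP [/asboolP Pi vi].
have [_ _ JM] := JP.
by rewrite -(submK (m := U_(i)%MM) (m' := v e)) ?lep1mP // mpolyXD; apply: JM.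
Qed.

Lemma face_ideal_vars {n : nat} (K : fieldType) (B : {set 'I_n}) :
  [set i | `[< face_ideal K B 'X_i >]]%SET = B.
Proof.
apply/setP => i; rewrite inE; apply/asboolP/idP => [|iB].
  by move/monomial_idealX/deg_on_gt0 => [j jB]; rewrite mnm1E eqb0 negbK => /eqP ->.
by apply/monomial_idealX/deg_on_gt0; exists i; rewrite // mnm1E eqxx.
Qed.

(** A prime containing the ideal contains the prime generated by its own
    variables, and these form a vertex cover.  Minimality of the prime thus
    matches minimality of the cover. *)
Lemma minimal_primes_mon {K : fieldType} {n q : nat} (v : 'I_q -> 'X_{1..n}) :
  minimal_primes (mon_ideal v [set: 'I_q]%SET : set {mpoly K[n]})
    = [set face_ideal K B | B in [set` min_cover_clutter (clutter_of v)]].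
Proof.
apply/seteqP; split=> [P [PP IP minP]|_ [B /= + <-]].
  have /minset_exists [B minB sB] := (mon_ideal_prime PP).1 IP.
  exists B; first by rewrite /= inE.
  apply: minP (face_ideal_prime K B) _ _.
    apply/(mon_ideal_prime (face_ideal_prime K B)).
    by rewrite face_ideal_vars (minsetp minB).
  have [JP _ _] := PP; apply: (face_ideal_sub _ _ JP) => i.
  by move/(fintype.subsetP sB); rewrite inE => /asboolP.
rewrite inE => minB; split; first exact: face_ideal_prime.
  apply/(mon_ideal_prime (face_ideal_prime K B)).
  by rewrite face_ideal_vars (minsetp minB).
move=> Q QP IQ QB.
have BE : [set i | `[< Q 'X_i >]]%SET = B.
  apply: (minsetinf minB); first exact/(mon_ideal_prime QP).
  apply/fintype.subsetP => i; rewrite inE => /asboolP /QB Bi.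
  by rewrite -(face_ideal_vars K B) inE; apply/asboolP.
apply/seteqP; split=> //; have [JP _ _] := QP.
by apply: (face_ideal_sub _ _ JP) => i; rewrite -BE inE => /asboolP.
Qed.

(** The condition on exponents that defines the symbolic powers. *)
Definition covered {n : nat} (C : {set {set 'I_n}}) (k : nat)
    (m : 'X_{1..n}) : Prop :=
  forall B, B \in min_cover_clutter C -> (k <= deg_on B m)%N.

(** Each minimal prime is generated by the variables in some minimal cover [B],
    and its [k]-th power is spanned by the monomials of degree at least [k] on
    [B]; intersecting over all [B] gives the claim. *)
Lemma symbolic_pow_mon {K : fieldType} {n q : nat} (v : 'I_q -> 'X_{1..n}) k :
  symbolic_pow (mon_ideal v [set: 'I_q]%SET) k
    = monomial_ideal K (covered (clutter_of v) k).
Proof.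
rewrite /symbolic_pow minimal_primes_mon; apply/seteqP; split=> [f If m mf B BD|].
  by apply: (face_ideal_pow_deg K B k f) => //; apply: If; exists B.
apply: monomial_ideal_sub.
  split=> [P PD|f g If Ig P PD|r f If P PD];
    have [J0 JD JM] := ideal_genP [set x | exists2 a : 'I_k -> {mpoly K[n]},
      forall j, P (a j) & x = \prod_(j < k) a j].
  - exact: J0.
  - by apply: JD; [apply: If|apply: Ig].
  - by apply: JM; apply: If.
by move=> m mC _ [B BD <-]; apply: face_ideal_powX; apply: mC.
Qed.

(** * Integral dependence of a monomial *)

(** Let [N] be the degree of an equation of integral dependence for
    [z = x^a t^b].  The monomial [x^(Na) t^(Nb)] of [z^N] must be cancelled by
    one in some [p_i z^i] with [i < N]; dividing by [z^i], the coefficient of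
    [t^(b(N-i))] in [p_i] involves [x^((N-i)a)], and [M = N - i] works. *)
Lemma integral_monomial {K : fieldType} {n : nat} (J : set {mpoly K[n]})
    (W : nat -> 'X_{1..n} -> Prop) (a : 'X_{1..n}) (b : nat) :
  (forall k, ideal_pow J k `<=` monomial_ideal K (W k)) ->
  integral_over (rees J) (tofrac ('X_[a] *: 'X^b : {poly {mpoly K[n]}})) ->
  exists2 M, (0 < M)%N & W (b * M)%N (a *+ M)%MM.
Proof.
move=> JW [p [pm pJ /rootP]]; set z := _ *: _; rewrite horner_map => /eqP.
rewrite tofrac_eq0 => /eqP pz0.
have p0 : (0 < size p)%N by rewrite size_poly_gt0 monic_neq0.
have zX i : z ^+ i = 'X_[a *+ i] *: 'X^(b * i) by rewrite exprZn mpolyXn exprM.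
pose N := (size p).-1.
(* [co f] reads off the coefficient of x^(Na) t^(Nb). *)
pose co (f : {poly {mpoly K[n]}}) := (f`_(b * N))@_(a *+ N).
have coD : {morph co : f g / f + g} by move=> f g; rewrite /co coefD mcoeffD.
have co0 : co 0 = 0 by rewrite /co coef0 mcoeff0.
have coE i : (i <= N)%N ->
    co (p`_i * z ^+ i) = (p`_i)`_(b * (N - i)) @_(a *+ (N - i)).
  move=> iN; rewrite /co zX -scalerAr coefZ coefMXn ltnNge leq_mul2l iN orbT /=.
  have -> : (a *+ N)%MM = (a *+ i + a *+ (N - i))%MM.
    by apply/mnmP => l; rewrite mnmDE !mulmnE -mulnDr subnKC.
  by rewrite mulrC mcoeffMX mulnBr.
have := congr1 co pz0; rewrite horner_coef (big_morph co coD co0) co0.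
rewrite -(ltn_predK p0) big_ord_recr /= coE // subnn muln0 mulm0n.
have -> : p`_N = 1 by apply/eqP; rewrite -[_ == _]/(p \is monic).
rewrite coef1 mcoeff1 eqxx => sum0.
suff [i pi] : exists i : 'I_N, (p`_i)`_(b * (N - i)) @_(a *+ (N - i)) != 0.
  exists (N - i)%N; first by rewrite subn_gt0.
  by apply: (JW _ _ (pJ i _)); rewrite mcoeff_msupp.
apply/existsP; apply: contraT; rewrite negb_exists => /forallP pi0.
move: sum0; rewrite big1 ?add0r; first by move/eqP; rewrite oner_eq0.
move=> i _; rewrite coE ?(ltnW (ltn_ord i)) //.
by have := pi0 i; rewrite negbK => /eqP.
Qed.

(** * From symbolic powers to ordinary powers *)

Lemma in_mon_pow_deg {n q : nat} {v : 'I_q -> 'X_{1..n}} {B : {set 'I_n}}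
    (covB : forall e, (0 < deg_on B (v e))%N) k m :
  in_mon_pow v k m -> (k <= deg_on B m)%N.
Proof.
elim: k m => // k IH m [e [m' [/IH km' ->]]].
by rewrite deg_onD -add1n leq_add.
Qed.

Lemma cover_deg {n q : nat} {v : 'I_q -> 'X_{1..n}} {B : {set 'I_n}} :
  B \in min_cover_clutter (clutter_of v) -> forall e, (0 < deg_on B (v e))%N.
Proof.
rewrite inE => /minsetp /forall_inP covB e; apply/deg_on_gt0.
have /set0Pn [i] := covB (mon_supp (v e)) (imset_f _ isT).
by rewrite !inE => /andP []; exists i.
Qed.

(** The combinatorial heart: one edge of a product dividing a multiple of [m] can
    be subtracted from [m] at the cost of lowering the degree on each minimal
    cover by no more than the induction allows. *)
Lemma covered_in_mon_pow {n q : nat} {v : 'I_q -> 'X_{1..n}}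
    (v_squarefree : forall k, squarefree_mon (v k))
    (small_int : forall S B : {set 'I_n}, S \in clutter_of v ->
       B \in min_cover_clutter (clutter_of v) -> (#|(S :&: B)%SET| <= 2)%N)
    (v_int : forall k m, covered (clutter_of v) k m ->
       exists2 M, (0 < M)%N & in_mon_pow v (k * M)%N (m *+ M)%MM) k m :
  covered (clutter_of v) k m -> in_mon_pow v k m.
Proof.
elim: k m => // k IH m Cm.
have [M M0] := v_int _ _ Cm.
move NE : (k.+1 * M)%N => N; case: N NE => [|N] NE /=; first by lia.
move=> [e [m' [Nm' Mm]]].
(* Exponents of [v e] are 0 or 1, and where one is 1 the multiple of [m], hence
   [m] itself, has a positive exponent. *)
have em : (v e <= m)%MM.
  apply/mnm_lepP => i; have := v_squarefree e i.
  have := congr1 (fun x : 'X_{1..n} => x i) Mm; rewrite mnmDE mulmnE.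
  by case: (v e i) (m i) => [|[|//]] [|] //; rewrite mul0n.
exists e, (m - v e)%MM; split; last by rewrite addmC submK.
apply: IH => B BD.
have mE : deg_on B m = (deg_on B (m - v e) + deg_on B (v e))%N.
  by rewrite -deg_onD submK.
have e2 : (deg_on B (v e) <= 2)%N.
  by rewrite deg_on_squarefree //; apply: small_int; rewrite ?imset_f.
(* In the tight case the edges other than [e] already account for all but one
   of the (k + 1)M units of degree on [B]; otherwise there is slack to lose two. *)
have := Cm B BD; rewrite leq_eqVlt => /orP [/eqP tight|].
  have := in_mon_pow_deg (cover_deg BD) _ _ Nm'.
  have := congr1 (deg_on B) Mm; rewrite deg_onMn -tight NE deg_onD.
  move: mE; rewrite -tight; lia.
by move: mE e2; lia.
Qed.

(** An element [x] of [A] is the fraction [x / 1] and a root of [X - x]. *)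
Lemma sub_integral_closure {S : idomainType} (A : set S) :
  A 0 -> A 1 -> (forall x, A x -> A (- x)) -> in_frac A `<=` integral_closure A.
Proof.
move=> A0 A1 AN _ [x Ax <-]; split.
  by exists x, 1; rewrite oner_eq0 tofrac1 divr1.
exists ('X - x%:P); split; first exact: monicXsubC.
  move=> i; rewrite coefB coefX coefC.
  by case: i => [|[|i]] /=; rewrite ?sub0r ?subr0 //; apply: AN.
by rewrite rmorphB /= map_polyX map_polyC /= root_XsubC.
Qed.

(** * Normality *)

Theorem proposition3p21 (K : fieldType) (n q g : nat)
    (v : 'I_q -> 'X_{1..n}) (I : set {mpoly K[n]})
    (I_gen : minimally_generated I v)
    (v_squarefree : forall k, squarefree_mon (v k))
    (v_deg : forall k, (2 <= mdeg (v k))%N)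
    (v_vars : forall i : 'I_n, exists k, (v k i != 0)%N)
    (I_height : ideal_height I g) (g_ge2 : (2 <= g)%N)
    (closure_eq : integral_closure (rees I) = in_frac (symbolic_rees I))
    (small_int : forall S B : {set 'I_n}, S \in clutter_of v ->
       B \in min_cover_clutter (clutter_of v) -> (#|(S :&: B)%SET| <= 2)%N) :
  is_normal (rees I).
Proof.
have [IE _] := I_gen; rewrite IE in closure_eq *.
set J := mon_ideal _ _ in closure_eq *.
have powJ k : is_ideal (ideal_pow J k) by apply: ideal_genP.
rewrite /is_normal; apply/seteqP; split; last first.
  apply: sub_integral_closure.
  - by move=> k; rewrite coef0; have [] := powJ k.
  - case=> [|k]; first by rewrite coef1; apply: ideal_pow0.
    by rewrite coef1; have [] := powJ k.+1.
  - move=> f If k; rewrite coefN -mulN1r.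
    by have [_ _] := powJ k; apply; apply: If.
(* It remains to show that the symbolic Rees algebra lies in the Rees algebra. *)
rewrite closure_eq => _ [f fS <-]; exists f => // k.
rewrite /J mon_ideal_pow => m mf.
apply: covered_in_mon_pow => // [{fS mf}{}k {}m Cm|].
  apply: (integral_monomial J (in_mon_pow v)).
    by move=> k'; rewrite /J mon_ideal_pow.
  suff [] : integral_closure (rees J) (tofrac ('X_[m] *: 'X^k)) by [].
  rewrite closure_eq; exists ('X_[m] *: 'X^k) => // l.
  rewrite coefZ coefXn; have [->|_] := eqVneq l k; rewrite ?mulr1 ?mulr0.
    by rewrite symbolic_pow_mon; apply/monomial_idealX.
  by rewrite symbolic_pow_mon => m'; rewrite msupp0.
by have := fS k; rewrite /J symbolic_pow_mon; apply.
Qed.
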